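(* Let $d\ge1$, let $k$ be a non-negative integer, let $A \subseteq \mathbb{S}^d$ be a finite generic $k$-balanced set, and let $a \in A$. Then the $k$-hefty spherical simplices of $A$ cover $\mathbb{S}^d$ exactly $\binom{d+k}{k}$ times, i.e. every $x\in\mathbb{S}^d$ generic with respect to $A$ lies in exactly $\binom{d+k}{k}$ $k$-hefty simplices of $A$; and the $k$-hefty simplices of $A$ having $a$ as a vertex cover every sufficiently small neighborhood of $a$ exactly $\binom{d+k-1}{d-1}$ times, i.e. there is $\varepsilon>0$ such that every $x\in\mathbb{S}^d$ generic with respect to $A$ with $\|x-a\|<\varepsilon$ lies in exactly $\binom{d+k-1}{d-1}$ such simplices having $a$ as a vertex.
   Context: $\mathbb{S}^d$ is the unit sphere in $\mathbb{R}^{d+1}$. A set $A\subseteq\mathbb{S}^d$ is $k$-balanced if every open hemisphere contains at least $k+1$ points of $A$. A finite $A\subseteq \mathbb{S}^d$ is generic if no $d+1$ of its points are linearly dependent in $\mathbb{R}^{d+1}$ and no $d+2$ of its points are affinely dependent in $\mathbb{R}^{d+1}$ (i.e. no $d+1$ on a common great $(d-1)$-sphere and no $d+2$ on a common $(d-1)$-sphere in $\mathbb{S}^d$). A point $x\in\mathbb{S}^d$ is generic with respect to $A$ if $x\notin A$ and $A\cup\{x\}$ is generic. The spherical $d$-simplex spanned by $d+1$ linearly independent points of $\mathbb{S}^d$ is the central projection to $\mathbb{S}^d$ of their Euclidean convex hull. Any $d+1$ points of generic $A$ lie on a unique $(d-1)$-sphere in $\mathbb{S}^d$, which bounds two open caps;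 its inside is the smaller of the two. A spherical $d$-simplex spanned by $d+1$ points of $A$ is $k$-hefty if exactly $k$ points of $A$ lie inside that $(d-1)$-sphere. *)

(* Defs.v *)
From mathcomp Require Import all_boot all_order all_algebra finmap.
From mathcomp Require Import boolp classical_sets reals.

Set Implicit Arguments.
Unset Strict Implicit.
Unset Printing Implicit Defensive.

Import Order.TTheory GRing.Theory Num.Theory.
Local Open Scope classical_set_scope.
Local Open Scope fset_scope.
Local Open Scope ring_scope.

Definition dotv {R : realType} {n : nat} (u v : 'rV[R]_n) : R :=
  (u *m v^T) 0 0.

(* The library's norm on row vectors is the sup norm. *)
Definition enorm {R : realType} {n : nat} (u : 'rV[R]_n) : R :=
  Num.sqrt (dotv u u).

Definition usphere (R : realType) (d : nat) : set 'rV[R]_d.+1 :=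
  [set x | enorm x = 1].
Arguments usphere : clear implicits.

Definition balanced {R : realType} {d : nat} (k : nat)
    (A : {fset 'rV[R]_d.+1}) : Prop :=
  forall u, usphere R d u -> (k.+1 <= #|` [fset y in A | (0 < dotv u y)%R]|)%N.

Definition affinely_dependent {R : realType} {n : nat}
    (B : {fset 'rV[R]_n}) : Prop :=
  exists c : 'rV[R]_n -> R,
    [/\ exists2 b, b \in B & c b != 0,
        \sum_(b <- B) c b = 0 &
        \sum_(b <- B) c b *: b = 0].

Definition generic {R : realType} {d : nat} (A : {fset 'rV[R]_d.+1}) : Prop :=
  [/\ ([set` A] `<=` usphere R d)%classic,
      forall B : {fset 'rV[R]_d.+1},
        B `<=` A -> #|` B| = d.+1 -> free B &
      forall B : {fset 'rV[R]_d.+1},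
        B `<=` A -> #|` B| = d.+2 -> ~ affinely_dependent B].

Definition generic_wrt {R : realType} {d : nat} (A : {fset 'rV[R]_d.+1})
    (x : 'rV[R]_d.+1) : Prop :=
  x \notin A /\ generic (x |` A).

Definition convex_hull {R : realType} {n : nat} (B : {fset 'rV[R]_n}) :
    set 'rV[R]_n :=
  [set y | exists c : 'rV[R]_n -> R,
     [/\ forall b, b \in B -> 0 <= c b,
         \sum_(b <- B) c b = 1 &
         y = \sum_(b <- B) c b *: b]].

Definition spherical_simplex {R : realType} {d : nat}
    (B : {fset 'rV[R]_d.+1}) : set 'rV[R]_d.+1 :=
  (fun y => (enorm y)^-1 *: y) @` convex_hull B.

(* For a unit vector u and -1 < t < 1, [subsphere u t] is a (d-1)-sphere in
   the unit sphere, and it bounds the two open caps [cap u t] and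
   [cap (- u) (- t)], of angular radii acos t and pi - acos t. *)
Definition subsphere {R : realType} {d : nat} (u : 'rV[R]_d.+1) (t : R) :
    set 'rV[R]_d.+1 :=
  [set y | usphere R d y /\ dotv u y = t].

Definition cap {R : realType} {d : nat} (u : 'rV[R]_d.+1) (t : R) :
    set 'rV[R]_d.+1 :=
  [set y | usphere R d y /\ t < dotv u y].

(* [0 < t] selects the smaller of the two caps. A sphere through d+1 linearly
   independent points has t != 0, and it is unique. *)
Definition inside {R : realType} {d : nat} (B : {fset 'rV[R]_d.+1}) :
    set 'rV[R]_d.+1 :=
  [set y | exists (u : 'rV[R]_d.+1) (t : R),
     [/\ usphere R d u, 0 < t < 1, ([set` B] `<=` subsphere u t)%classic & cap u t y]].

(* A simplex is represented by its vertex set B. *)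
Definition hefty {R : realType} {d : nat} (k : nat)
    (A B : {fset 'rV[R]_d.+1}) : Prop :=
  [/\ B `<=` A, #|` B| = d.+1 & #|` [fset y in A | `[< inside B y >]]| = k].

Definition hefty_at {R : realType} {d : nat} (k : nat)
    (A : {fset 'rV[R]_d.+1}) (x : 'rV[R]_d.+1) : {fset {fset 'rV[R]_d.+1}} :=
  [fset B in fpowerset A | `[< hefty k A B /\ spherical_simplex B x >]].

(* Main.v *)
Require Import Defs.
From mathcomp Require Import all_boot all_order all_algebra finmap.
From mathcomp Require Import boolp classical_sets reals.
From mathcomp Require Import zify ring lra.
(* Restores the finite-set lemmas shadowed by [classical_sets]. *)
From mathcomp Require Import fintype finset finmap.

(**
A (d+1)-subset B of A determines the vector w_B with <w_B, b> = 1 for b in B,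
and the inside of its sphere is the set of y with <w_B, y> > 1. The simplex of
B contains x exactly when w_B maximizes <x, .> over the constraints <., b> <= 1,
b in B. Hence if S is A with at most k points removed, then balancedness makes
the linear program "maximize <x, w> subject to <w, y> <= 1 for y in S" bounded,
genericity makes its optimal basis unique, and the optimal basis of S is the
only B contained in S that has x in its simplex and no point of S inside.
Double counting the pairs (removed set of size j, optimal basis) gives, with
n = |A| and g_l the number of l-hefty simplices containing x,
  sum_l g_l C(n-d-1-l, j-l) = C(n, j)   for j <= k,
a triangular system with solution g_l = C(d+l, l).

For the second claim the removed sets avoid a. If x is close to a, then every
optimal basis of an S containing a contains a: otherwise <w_B, a> < 1 = <a, a>,
so the feasible point a beats w_B in the direction x. The right-hand side of
the system becomes C(n-1, j), and its solution is C(d-1+l, l).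
*)

Set Implicit Arguments.
Unset Strict Implicit.
Unset Printing Implicit Defensive.

Import Order.TTheory GRing.Theory Num.Theory.

(** * Counting by levels *)

Lemma hockey_stick e j : \sum_(l < j.+1) 'C(e + l, l) = 'C(e.+1 + j, j).
Proof.
elim: j => [|j IHj]; first by rewrite big_ord_recr big_ord0 /= !bin0.
by rewrite big_ord_recr /= IHj !addnS binS addSn addnC.
Qed.

(** Classify the [j]-subsets of [m + e.+1] ordered points by the position of the [e.+1]-st point
    left out, where [l] is the number of chosen points before it; [j <= m] ensures that this point
    exists. The formal proof uses Pascal's rule, with the hockey-stick identity at the boundary. *)
Lemma bin_convolution e m j : j <= m ->
  \sum_(l < j.+1) 'C(e + l, l) * 'C(m - l, j - l) = 'C(m + e.+1, j).
Proof.
elim: m j => [|m IHm] j; first by case: j => // _; rewrite big_ord_recr big_ord0 /= !bin0.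
rewrite leq_eqVlt => /orP[/eqP->|].
  rewrite addnC -hockey_stick; apply: eq_bigr => l _.
  by rewrite binn muln1.
rewrite ltnS; case: j => [|j] lejm.
  by rewrite big_ord_recr big_ord0 /= !bin0.
rewrite addSn [RHS]binS -IHm // -IHm; last exact: ltnW.
rewrite big_ord_recr [in RHS]big_ord_recr /= !subnn !bin0 addnAC; congr addn.
rewrite -big_split; apply: eq_bigr => l _ /=.
rewrite -mulnDr; congr muln.
have lelj : l <= j by rewrite -ltnS.
by rewrite subSn ?(leq_trans lelj) ?(ltnW lejm) // subSn.
Qed.

Lemma card_between (T : finType) (V U : {set T}) j : V \subset U -> #|V| <= j ->
  #|[set X : {set T} | [&& V \subset X, X \subset U & #|X| == j]]|
    = 'C(#|U| - #|V|, j - #|V|).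
Proof.
move=> sVU leVj; rewrite -cardsDS // -cards_draws.
have inj : {in [set A : {set T} | A \subset U :\: V & #|A| == j - #|V|] &,
    injective (setU V)}.
  move=> X Y; rewrite !inE !subsetD => /andP[/andP[_ dX] _] /andP[/andP[_ dY] _].
  move=> /(congr1 (fun Z => Z :\: V)).
  by rewrite !setDUl setDv !set0U (setDidPl dX) (setDidPl dY).
rewrite -(card_in_imset inj); apply: eq_card => X; rewrite !inE.
apply/and3P/imsetP => [[sVX sXU /eqP cX]|[Y]].
  exists (X :\: V); last by rewrite setDE setUIr setUCr setIT (setUidPr sVX).
  by rewrite inE setSD //= cardsDS // cX.
rewrite inE subsetD => /andP[/andP[sYU dYV] /eqP cY] ->.
rewrite subsetUl subUset sVU sYU cardsU cY.
by move: dYV; rewrite disjoint_sym -setI_eq0 => /eqP->; rewrite cards0 subn0 subnKC.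
Qed.

(** In the application [i] is a basis, [V i] its violated constraints, [U i] the complement of the
    basis, and [X] a removed set. Counting the pairs of [X] and [i] with [V i \subset X],
    [X \subset U i] and [#|X| = j] in two ways gives the triangular system. *)
Lemma count_by_level (T I : finType) (G : {set I}) (U V : I -> {set T})
    (E : {set T}) (m e k : nat) :
    #|E| = m + e.+1 -> k <= m ->
    (forall i, i \in G -> [/\ V i \subset U i, U i \subset E & #|U i| = m]) ->
    (forall X : {set T}, X \subset E -> #|X| <= k ->
       #|[set i in G | (V i \subset X) && (X \subset U i)]| = 1) ->
  forall j, j <= k -> #|[set i in G | #|V i| == j]| = 'C(e + j, j).
Proof.
move=> cE lekm GUV uniqX.
have count j : j <= k ->
    \sum_(l < j.+1) #|[set i in G | #|V i| == l]| * 'C(m - l, j - l)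
      = 'C(m + e.+1, j).
  move=> lejk; rewrite -cE -cards_draws -sum1_card.
  transitivity (\sum_(X in [set X : {set T} | X \subset E & #|X| == j])
      \sum_(i in G | (V i \subset X) && (X \subset U i)) 1); last first.
    apply: eq_bigr => X; rewrite inE => /andP[sXE /eqP cX].
    rewrite -[RHS](uniqX X) ?cX // -sum1_card; apply: eq_bigl => i; by rewrite inE.
  rewrite (exchange_big_dep (mem G)) /=; last by move=> X i _ /andP[].
  transitivity (\sum_(i in G) \sum_(l < j.+1 | l == #|V i| :> nat) 'C(m - l, j - l)).
    rewrite (exchange_big_dep predT) //=; apply: eq_bigr => l _.
    rewrite sum_nat_const; congr muln; apply: eq_card => i.
    by rewrite !inE unfold_in eq_sym.
  apply: eq_bigr => i iG; have [sVU sUE cU] := GUV i iG.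
  (* If [V i] has more than [j] elements, both sides vanish. *)
  transitivity #|[set X : {set T} | [&& V i \subset X, X \subset U i & #|X| == j]]|.
    have [leVj|ltjV] := leqP #|V i| j.
      rewrite card_between // cU (bigD1 (Ordinal (leVj : #|V i| < j.+1))) //=.
      rewrite big1 ?addn0 // => l /andP[/eqP eql /negP[]].
      by apply/eqP/val_inj.
    rewrite big1 => [|l /eqP eql]; last first.
      by have := ltn_ord l; rewrite eql ltnS leqNgt ltjV.
    symmetry; apply/eqP; rewrite cards_eq0; apply/eqP/setP => X; rewrite !inE.
    apply/negP => /and3P[/subset_leq_card + _ /eqP cX].
    by rewrite cX leqNgt ltjV.
  rewrite -sum1_card; apply: eq_bigl => X; rewrite !inE iG /=.
  case: (boolP (X \subset U i)) => [sXU|]; last by rewrite !andbF.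
  by rewrite (subset_trans sXU sUE) /= andbT andbC.
(* The term [l = j] has coefficient 1 and the lower levels are known by induction, so comparison
   with [bin_convolution] isolates level [j]. *)
elim/ltn_ind => j IHj lejk; have := count j lejk.
rewrite -(bin_convolution e (leq_trans lejk lekm)) !big_ord_recr /= !subnn !bin0 !muln1.
rewrite (eq_bigr (fun l : 'I_j => 'C(e + l, l) * 'C(m - l, j - l))); last first.
  by move=> l _; rewrite IHj // (leq_trans (ltnW (ltn_ord l))).
exact: addnI.
Qed.

Local Open Scope fset_scope.
Local Open Scope ring_scope.

(** * Linear algebra and the Farkas lemma *)

Section DotProduct.
Context {R : realType} {n : nat}.
Implicit Types (u v w x : 'rV[R]_n) (c : R).

Lemma dotvE u v : dotv u v = \sum_i u 0 i * v 0 i.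
Proof. by rewrite /dotv mxE; apply: eq_bigr => i _; rewrite mxE. Qed.

Lemma dotvC u v : dotv u v = dotv v u.
Proof. by rewrite !dotvE; apply: eq_bigr => i _; rewrite mulrC. Qed.

Lemma dotvDr u v w : dotv u (v + w) = dotv u v + dotv u w.
Proof. by rewrite /dotv linearD mulmxDr mxE. Qed.

Lemma dotvZr u c v : dotv u (c *: v) = c * dotv u v.
Proof. by rewrite /dotv linearZ -scalemxAr mxE. Qed.

Lemma dotvZl u c v : dotv (c *: v) u = c * dotv v u.
Proof. by rewrite !(dotvC _ u) dotvZr. Qed.

Lemma dotvBr u v w : dotv u (v - w) = dotv u v - dotv u w.
Proof. by rewrite -scaleN1r dotvDr dotvZr mulN1r. Qed.

Lemma dotvBl u v w : dotv (v - w) u = dotv v u - dotv w u.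
Proof. by rewrite !(dotvC _ u) dotvBr. Qed.

Lemma dot0v u : dotv 0 u = 0.
Proof. by rewrite -(scale0r 0) dotvZl mul0r. Qed.

Lemma dotv_sumr (I : Type) (r : seq I) (P : pred I) (F : I -> 'rV[R]_n) u :
  dotv u (\sum_(i <- r | P i) F i) = \sum_(i <- r | P i) dotv u (F i).
Proof.
by apply: (big_morph _ (dotvDr u)); rewrite dotvC dot0v.
Qed.

Lemma dotvv_ge0 u : 0 <= dotv u u.
Proof. by rewrite dotvE sumr_ge0 // => i _; rewrite -expr2 sqr_ge0. Qed.

Lemma dotvv_eq0 u : (dotv u u == 0) = (u == 0).
Proof.
apply/eqP/eqP => [|->]; last exact: dot0v.
rewrite dotvE => /eqP; rewrite psumr_eq0; last by move=> i _; rewrite -expr2 sqr_ge0.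
move=> /allP u0; apply/rowP => i; rewrite mxE; apply/eqP.
by have := u0 i (mem_index_enum i); rewrite mulf_eq0 orbb.
Qed.

Lemma dotvv_gt0 u : (0 < dotv u u) = (u != 0).
Proof. by rewrite lt_def dotvv_ge0 dotvv_eq0 andbT. Qed.

Lemma enorm_gt0 u : u != 0 -> 0 < enorm u.
Proof. by rewrite sqrtr_gt0 dotvv_gt0. Qed.

Lemma sqr_enorm u : enorm u ^+ 2 = dotv u u.
Proof. by rewrite sqr_sqrtr ?dotvv_ge0. Qed.

Lemma enormZ c u : 0 <= c -> enorm (c *: u) = c * enorm u.
Proof.
move=> c0; rewrite /enorm dotvZl dotvZr mulrA -expr2.
by rewrite sqrtrM ?sqr_ge0 // sqrtr_sqr ger0_norm.
Qed.

(* Young's inequality [2 e <p,q> <= e^2 |p|^2 + |q|^2], with e the radius,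
   replaces Cauchy-Schwarz here. *)
Lemma dotv_lt0_near (p a : 'rV[R]_n) : dotv p a < 0 ->
  exists2 e : R, 0 < e & forall x, enorm (x - a) < e -> dotv p x < 0.
Proof.
move=> pa0; have pp0 := dotvv_ge0 p.
have den0 : 0 < dotv p p + 1 by lra.
pose e : R := - dotv p a / (dotv p p + 1).
have eE : e * (dotv p p + 1) = - dotv p a by rewrite divfK // gt_eqF.
have e0 : 0 < e by rewrite divr_gt0 // oppr_gt0.
exists e => // x; have {2}-> : x = a + (x - a) by rewrite addrC subrK.
move: (x - a) => q xa.
have qe : dotv q q < e ^+ 2.
  by rewrite -sqr_enorm ltrXn2r // ?sqrtr_ge0.
have := dotvv_ge0 (e *: p - q).
rewrite !(dotvBl, dotvBr) !(dotvZl, dotvZr) (dotvC q p) => young.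
rewrite dotvDr.
have h : e * (2 * dotv p q) <= e * (e * (dotv p p + 1)) by nra.
rewrite ler_pM2l // eE in h.
lra.
Qed.

End DotProduct.

(* Induction on [s]: if the functional [u] separating [x] from the tail is
   positive on the head [y], project along [y] onto the kernel of [u]. *)
Lemma farkas (R : realType) (n : nat) (T : eqType) (s : seq T)
    (v : T -> 'rV[R]_n) (x : 'rV[R]_n) : uniq s ->
  (exists2 c : T -> R, forall t, 0 <= c t & x = \sum_(t <- s) c t *: v t) \/
  (exists2 u, forall t, t \in s -> dotv u (v t) <= 0 & 0 < dotv u x).
Proof.
elim: s v x => [|y s IHs] v x /=.
  move=> _; have [->|x0] := eqVneq x 0.
    by left; exists (fun=> 0) => //; rewrite big_nil.
  by right; exists x => //; rewrite dotvv_gt0.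
move=> /andP[ys us].
have recoef (c : T -> R) (c0 : R) : \sum_(t <- s) (if t == y then c0 else c t) *: v t
    = \sum_(t <- s) c t *: v t.
  by apply: eq_big_seq => t ts; case: eqP => // ty; rewrite -ty ts in ys.
have [[c c0 xE]|[u us0 ux]] := IHs v x us.
  left; exists (fun t => if t == y then 0 else c t) => [t|]; first by case: ifP.
  by rewrite big_cons eqxx scale0r add0r recoef.
have [uy|uy] := lerP (dotv u (v y)) 0.
  by right; exists u => // t; rewrite inE => /orP[/eqP->|/us0].
pose pr z : 'rV[R]_n := z - (dotv u z / dotv u (v y)) *: v y.
have [[c c0 xE]|[w ws wx]] := IHs (pr \o v) (pr x) us; last first.
  (* Composing [w] with [pr] gives again a functional, and it vanishes on [v y]. *)
  have prE z : dotv (w - (dotv w (v y) / dotv u (v y)) *: u) z = dotv w (pr z).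
    by rewrite /pr dotvBl dotvBr dotvZl dotvZr; ring.
  right; exists (w - (dotv w (v y) / dotv u (v y)) *: u); last by rewrite prE.
  move=> t; rewrite inE prE => /orP[/eqP->|/ws//].
  by rewrite /pr divff ?gt_eqF // scale1r subrr dotvC dot0v.
left.
(* Applying [u] to the desired expansion of [x] forces this coefficient of [v y]. It is nonnegative
   because [u] is positive at [x] and nonpositive on the tail. *)
pose c1 := (dotv u x - \sum_(t <- s) c t * dotv u (v t)) / dotv u (v y).
exists (fun t => if t == y then c1 else c t) => [t|].
  case: ifP => // _; rewrite divr_ge0 ?(ltW uy) // subr_ge0.
  apply: le_trans (ltW ux); rewrite big_seq sumr_le0 // => i si.
  by rewrite mulr_ge0_le0 // us0.
rewrite big_cons eqxx recoef.
move/eqP: xE; rewrite {1}/pr subr_eq => /eqP xE.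
rewrite {1}xE /c1 mulrBl scalerBl mulr_suml scaler_suml.
rewrite addrC -addrA; congr (_ + _); rewrite addrC -sumrB; apply: eq_bigr => t _ /=.
by rewrite /pr scalerBr scalerA mulrA.
Qed.

(** The largest step [h] along [- e] that keeps [c] nonnegative is the minimum of the ratios
    [c t / e t] with [e t > 0]; the index [t0] attaining it is the one to drop, both when shrinking
    a cone and when pivoting. *)
Lemma ratio_test (R : realFieldType) (T : finType) (F : {set T}) (c e : T -> R) :
    (forall t, t \in F -> 0 <= c t) -> (exists2 t, t \in F & 0 < e t) ->
  exists t0 (h : R), [/\ t0 \in F, 0 <= h, 0 < e t0, c t0 = h * e t0 &
    forall t, t \in F -> h * e t <= c t].
Proof.
move=> c0 [t1 t1F et1].
have P1 : [pred t | (t \in F) && (0 < e t)] t1 by rewrite /= t1F.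
case: (@arg_minP _ _ _ t1 [pred t | (t \in F) && (0 < e t)] (fun t => c t / e t) P1).
move=> t0 /andP[t0F et0] min.
have h0 : 0 <= c t0 / e t0 by rewrite divr_ge0 ?c0 // ltW.
exists t0, (c t0 / e t0); split=> //; first by rewrite divfK // gt_eqF.
move=> t tF; have [et|et] := ltrP 0 (e t).
  by rewrite -ler_pdivlMr // min //= tF.
by apply: le_trans (c0 t tF); rewrite mulr_ge0_le0.
Qed.

Section Family.
Context {R : realType} {n : nat} {T : finType}.
Variable v : T -> 'rV[R]_n.
Implicit Types (B F S : {set T}) (c : T -> R).

Definition independent B := forall c,
  \sum_(t in B) c t *: v t = 0 -> forall t, t \in B -> c t = 0.

Definition in_cone B (x : 'rV[R]_n) := exists2 c,
  forall t, t \in B -> 0 <= c t & x = \sum_(t in B) c t *: v t.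

Let mx B : 'M[R]_(#|B|, n) := \matrix_(i < #|B|) v (enum_val i).

Lemma row_combination B (r : 'rV[R]_#|B|) :
  exists2 c : T -> R, forall i, c (enum_val i) = r 0 i &
    r *m mx B = \sum_(t in B) c t *: v t.
Proof.
have [t0 t0B|B0] := pickP (mem B).
  exists (fun t => r 0 (enum_rank_in t0B t)) => [i|]; first by rewrite enum_valK_in.
  rewrite big_enum_val mulmx_sum_row; apply: eq_bigr => i _.
  by rewrite enum_valK_in rowK.
exists (fun=> 0) => [i|]; first by have := enum_valP i; rewrite [_ \in _]B0.
rewrite (big_pred0 _ _ _ _ B0) mulmx_sum_row big1 // => i _.
by have := enum_valP i; rewrite [_ \in _]B0.
Qed.

Lemma independent_row_free B : independent B -> row_free (mx B).
Proof.
move=> indB; apply: inj_row_free => r; have [c cE ->] := row_combination r.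
by move=> /indB c0; apply/rowP => i; rewrite mxE -cE c0 // enum_valP.
Qed.

Lemma independent_spans B : independent B -> #|B| = n ->
  forall y, exists c, y = \sum_(t in B) c t *: v t.
Proof.
move=> /independent_row_free rfB cB y.
have : (y <= mx B)%MS by apply: submx_full; rewrite /row_full (eqP rfB) cB.
by move=> /submxP[r ->]; have [c _ ->] := row_combination r; exists c.
Qed.

Lemma dotv_basis_inj B u w : independent B -> #|B| = n ->
  (forall t, t \in B -> dotv u (v t) = dotv w (v t)) -> u = w.
Proof.
move=> indB cB uw; apply/eqP; rewrite -subr_eq0 -dotvv_eq0; apply/eqP.
have [c cE] := independent_spans indB cB (u - w).
by rewrite {2}cE dotv_sumr big1 // => t tB; rewrite dotvZr dotvBl uw // subrr mulr0.
Qed.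

(** A right inverse of the row-free matrix of [B], applied to the all-ones column, gives [w]. *)
Lemma independent_functional B : independent B ->
  exists w, forall t, t \in B -> dotv w (v t) = 1.
Proof.
move=> /independent_row_free/row_freeP[M MK].
exists (M *m const_mx 1)^T => t tB.
have -> : v t = row (enum_rank_in tB t) (mx B) by rewrite rowK enum_rankK_in.
by rewrite dotvC /dotv trmxK -row_mul mulmxA MK mul1mx !mxE.
Qed.

Lemma dependent_large F : (n < #|F|)%N ->
  exists2 c, \sum_(t in F) c t *: v t = 0 & exists2 t, t \in F & 0 < c t.
Proof.
move=> ltnF; suff: ~ independent F.
  move=> /existsNP[c /not_implyP[cE /existsNP[t /not_implyP[tF /eqP]]]].
  rewrite neq_lt => /orP[ct|ct]; last by exists c => //; exists t.
  exists (fun t => - c t); last by exists t => //; rewrite oppr_gt0.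
  by under eq_bigr do rewrite scaleNr; rewrite sumrN cE oppr0.
move=> /independent_row_free/eqP rF.
by have := rank_leq_col (mx F); rewrite rF leqNgt ltnF.
Qed.

(** Caratheodory's theorem for cones: while there are more than [n] vectors, subtracting a suitable
    multiple of a linear dependence kills one coefficient. *)
Lemma in_cone_shrink S x : (n <= #|S|)%N -> in_cone S x ->
  exists B, [/\ B \subset S, #|B| = n & in_cone B x].
Proof.
elim: {S}#|S| {-2}S (leqnn #|S|) => [|m IHm] S leSm lenS coneS.
  by exists S; split=> //; apply/eqP; rewrite eqn_leq lenS (leq_trans leSm).
have [ltnS|] := ltnP n #|S|; last first.
  by exists S; split=> //; apply/eqP; rewrite eqn_leq lenS andbT.
have [c c0 xE] := coneS; have [e eE e0] := dependent_large ltnS.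
have [t0 [h [t0S h0 et0 ct0 hc]]] := ratio_test c0 e0.
have [|||B [sBS cB coneB]] := IHm (S :\ t0).
- by move: leSm; rewrite (cardsD1 t0) t0S.
- by move: ltnS; rewrite (cardsD1 t0) t0S.
- exists (fun t => c t - h * e t).
    by move=> t; rewrite inE => /andP[_ tS]; rewrite subr_ge0 hc.
  transitivity (\sum_(t in S) (c t - h * e t) *: v t).
    under [RHS]eq_bigr do rewrite scalerBl -scalerA.
    by rewrite sumrB -scaler_sumr eE scaler0 subr0.
  by rewrite (big_setD1 t0) //= ct0 subrr scale0r add0r.
by exists B; split=> //; apply: subset_trans sBS (subD1set _ _).
Qed.

Lemma positively_spanning_cone S x : x != 0 ->
    (forall u, u != 0 -> exists2 t, t \in S & 0 < dotv u (v t)) ->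
  in_cone S x.
Proof.
move=> x0 pos; have [[c c0 xE]|[u us ux]] := farkas v x (enum_uniq S).
  by exists c => //; rewrite xE big_enum.
have [|t tS] := pos u; first by apply: contraTneq ux => ->; rewrite dot0v ltxx.
by rewrite ltNge us // mem_enum.
Qed.

End Family.

Lemma orthogonal_exists (R : realType) (d m : nat) (f : 'I_m -> 'rV[R]_d.+1) :
    (m <= d)%N ->
  exists2 u, u != 0 & forall i, dotv u (f i) = 0.
Proof.
move=> lemd; pose M : 'M[R]_(m, d.+1) := \matrix_i f i.
have : kermx M^T != 0.
  by rewrite kermx_eq0 /row_free neq_ltn ltnS (leq_trans (rank_leq_col _)).
move=> /rowV0Pn[u /sub_kermxP uM u0]; exists u => // i.
have -> : f i = row i M by rewrite rowK.
by rewrite /dotv tr_row colE mulmxA uM mul0mx mxE.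
Qed.

(** Take a hyperplane through the origin and [minn d #|T|] of the vectors. An open side of it misses
    these and still contains more than [k] others. The minimum allows the choice before [d <= #|T|]
    is known. *)
Lemma balanced_card (R : realType) (d k : nat) (T : finType) (v : T -> 'rV[R]_d.+1) :
    (forall u : 'rV[R]_d.+1, u != 0 -> (k < #|[set t | (0 < dotv u (v t))%R]|)%N) ->
  (d.+1 + k <= #|T|)%N.
Proof.
move=> v_balanced; pose m := minn d #|T|.
pose f (i : 'I_m) : T := enum_val (widen_ord (geq_minr d #|T|) i).
have [u u0 uf] := orthogonal_exists (v \o f) (geq_minl d #|T|).
have f_inj : injective f.
  by move=> i j /enum_val_inj/(congr1 val)/= /val_inj.
have := v_balanced _ u0.
have disj : [set t | 0 < dotv u (v t)] :&: f @: setT = set0.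
  apply/setP => t; rewrite !inE; apply/negP => /andP[+ /imsetP[i _ tE]].
  by rewrite tE [dotv _ _]uf ltxx.
have : (#|[set t | (0 < dotv u (v t))%R]| + #|f @: setT| <= #|T|)%N.
  by rewrite -cardsUI disj cards0 addn0 max_card.
rewrite card_imset // cardsT card_ord /m; lia.
Qed.

(** * Optimal bases *)

Section Levels.
Context {R : realType} {d : nat} {T : finType}.
Variables (v : T -> 'rV[R]_d.+1) (w : {set T} -> 'rV[R]_d.+1).
Hypothesis v_indep : forall B : {set T}, #|B| = d.+1 -> independent v B.
Hypothesis w_tight : forall (B : {set T}) t, #|B| = d.+1 -> t \in B ->
  dotv (w B) (v t) = 1.
Hypothesis w_ntight : forall (B : {set T}) t, #|B| = d.+1 -> t \notin B ->
  dotv (w B) (v t) != 1.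

Variable x : 'rV[R]_d.+1.
Hypothesis x_neq0 : x != 0.
Hypothesis x_coef_neq0 : forall (B : {set T}) (c : T -> R), #|B| = d.+1 ->
  x = \sum_(t in B) c t *: v t -> forall t, t \in B -> c t != 0.

Definition violated (B : {set T}) := [set t | 1 < dotv (w B) (v t)].

(* [w B] is an optimal vertex of the linear program: maximize [dotv x]
   subject to [dotv (v t) <= 1] for [t] in [S]. *)
Definition optimal_basis (S B : {set T}) := [/\ B \subset S, #|B| = d.+1, in_cone v B x &
  forall t, t \in S -> dotv (w B) (v t) <= 1].

Lemma dotv_combination (B : {set T}) (c : T -> R) y : #|B| = d.+1 ->
  y = \sum_(t in B) c t *: v t -> dotv (w B) y = \sum_(t in B) c t.
Proof.
move=> cB ->; rewrite dotv_sumr; apply: eq_bigr => t tB.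
by rewrite dotvZr w_tight // mulr1.
Qed.

(** Complementary slackness: the slacks of [w B'] on [B], weighted by the coefficients of [x], sum
    to at most 0, so each product vanishes. These coefficients are nonzero, hence [w B'] is tight on
    all of [B], and [w_ntight] puts [B] inside [B']. *)
Lemma optimal_basis_unique S B B' :
  optimal_basis S B -> optimal_basis S B' -> B = B'.
Proof.
move=> [sB cB [c c0 xE] oB] [sB' cB' [c' c'0 xE'] oB'].
have le_opt : dotv (w B) x <= dotv (w B') x.
  rewrite (dotv_combination cB' xE') {1}xE' dotv_sumr; apply: ler_sum => t tB'.
  by rewrite dotvZr ler_piMr ?c'0 // oB // (subsetP sB').
have slack0 : \sum_(t in B) c t * (1 - dotv (w B') (v t)) == 0.
  have slack_ge0 t : t \in B -> 0 <= c t * (1 - dotv (w B') (v t)).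
    by move=> tB; rewrite mulr_ge0 ?c0 // subr_ge0 oB' // (subsetP sB).
  rewrite eq_le sumr_ge0 // andbT.
  under eq_bigr do rewrite mulrBr mulr1 -dotvZr.
  by rewrite sumrB -dotv_sumr -xE -(dotv_combination cB xE) subr_le0.
have tight t : t \in B -> dotv (w B') (v t) = 1.
  move: slack0; rewrite psumr_eq0 => [/allP slack0 tB|s sB0]; last first.
    by rewrite mulr_ge0 ?c0 // subr_ge0 oB' // (subsetP sB).
  have := slack0 t (mem_index_enum t); rewrite tB mulf_eq0 subr_eq0.
  by rewrite (negbTE (x_coef_neq0 cB xE tB)) => /eqP.
apply/eqP; rewrite eqEcard cB cB' leqnn andbT; apply/subsetP => t tB.
by apply/negP => /negP /(w_ntight cB')/eqP; rewrite tight.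
Qed.

(* If a constraint [y] is violated, a simplex pivot brings [y] into the basis
   and decreases the dual objective [dotv (w B) x]. *)
Lemma pivot (B : {set T}) y : #|B| = d.+1 -> in_cone v B x -> y \in violated B ->
  exists B' : {set T}, [/\ B' \subset y |: B, #|B'| = d.+1, in_cone v B' x &
    dotv (w B') x < dotv (w B) x].
Proof.
move=> cB [c c0 xE]; rewrite inE => viol_y.
have [e yE] := independent_spans (v_indep cB) cB (v y).
have ynB : y \notin B by apply: contraTN viol_y => /(w_tight cB) ->; rewrite ltxx.
have sume := dotv_combination cB yE.
(* The coefficients [e] sum to [dotv (w B) (v y) > 1], so one of them is positive. *)
have e_pos : exists2 t, t \in B & 0 < e t.
  have [[t tB et]|noe] := pselect (exists2 t, t \in B & 0 < e t); first by exists t.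
  move: viol_y; rewrite sume => /(lt_trans ltr01); rewrite ltNge sumr_le0 // => t tB.
  by rewrite leNgt; apply/negP => et; apply: noe; exists t.
have [t0 [h [t0B h0 et0 ct0 hc]]] := ratio_test c0 e_pos.
have h_gt0 : 0 < h.
  rewrite lt_def h0 andbT; apply: contraNneq (x_coef_neq0 cB xE t0B) => h_eq0.
  by rewrite ct0 h_eq0 mul0r.
have yn : y \notin B :\ t0 by rewrite inE negb_and ynB orbT.
pose c' t := if t == y then h else c t - h * e t.
have cB' : #|y |: (B :\ t0)| = d.+1.
  by rewrite cardsU1 yn; move: cB; rewrite (cardsD1 t0) t0B.
(* Stated for any module because it is used twice: with [F := v] for the expansion of [x], and with
   [F] constantly 1 for the sum of the coefficients, which is the dual objective. *)
have sum_c' (V : lmodType R) (F : T -> V) : \sum_(t in y |: (B :\ t0)) c' t *: F t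
    = h *: F y + \sum_(t in B) (c t - h * e t) *: F t.
  rewrite big_setU1 //= {1}/c' eqxx; congr (_ + _).
  rewrite [RHS](big_setD1 t0) //= ct0 subrr scale0r add0r.
  by apply: eq_bigr => t tB; rewrite /c'; case: eqP tB yn => // -> ->.
have xE' : x = \sum_(t in y |: (B :\ t0)) c' t *: v t.
  rewrite sum_c'; under eq_bigr do rewrite scalerBl -scalerA.
  by rewrite sumrB -scaler_sumr -yE -xE addrC subrK.
exists (y |: (B :\ t0)); split=> //.
- by rewrite setUS // subD1set.
- exists c' => // t; rewrite !inE /c' => /orP[->//|/andP[_ tB]].
  by case: ifP => // _; rewrite subr_ge0 hc.
rewrite (dotv_combination cB' xE') (dotv_combination cB xE).
have -> : \sum_(t in y |: B :\ t0) c' t = h + \sum_(t in B) (c t - h * e t).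
  have := sum_c' R^o (fun=> 1); rewrite /GRing.scale /= mulr1.
  by under eq_bigr do rewrite mulr1; under [in RHS]eq_bigr do rewrite mulr1.
rewrite sumrB -mulr_sumr -sume; nra.
Qed.

(** Among the finitely many candidate bases one minimizes the dual objective; a violated constraint
    would allow a pivot to a better one. This replaces a termination argument for the simplex
    method. *)
Lemma optimal_basis_exists (S : {set T}) : (d.+1 <= #|S|)%N ->
    (forall u, u != 0 -> exists2 t, t \in S & 0 < dotv u (v t)) ->
  exists B, optimal_basis S B.
Proof.
move=> leS pos.
have [B0 [sB0 cB0 coneB0]] := in_cone_shrink leS (positively_spanning_cone x_neq0 pos).
pose cand := [pred B : {set T} | [&& B \subset S, #|B| == d.+1 & `[< in_cone v B x >]]].
have cand0 : cand B0 by rewrite /= sB0 cB0 eqxx; apply/asboolP.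
case: (@arg_minP _ _ _ B0 cand (fun B => dotv (w B) x) cand0).
move=> B /and3P[sB /eqP cB /asboolP coneB] min.
exists B; split=> // y yS; rewrite leNgt; apply/negP => viol_y.
have [|B' [sB' cB' coneB' ltB']] := @pivot B y cB coneB; first by rewrite inE.
have := min B'; rewrite leNgt ltB' /= cB' eqxx asboolT // andbT => /(_ _)/negP; apply=> //.
by rewrite (subset_trans sB') // subUset sub1set yS.
Qed.

Variable k : nat.
Hypothesis v_balanced : forall u : 'rV[R]_d.+1, u != 0 ->
  (k < #|[set t | (0 < dotv u (v t))%R]|)%N.

(** [Q] and [E] serve both claims: all bases, with arbitrary removed sets and [e = d]; or the bases
    containing [a], with removed sets avoiding [a] and [e = d - 1]. *)
Lemma card_level (Q : pred {set T}) (E : {set T}) e :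
    #|E| = (#|T| - d.+1 + e.+1)%N ->
    (forall B, Q B -> ~: B \subset E) ->
    (forall (X B : {set T}), X \subset E -> optimal_basis (~: X) B -> Q B) ->
  #|[set B : {set T} | [&& #|B| == d.+1, `[< in_cone v B x >], Q B & #|violated B| == k]]|
    = 'C(e + k, k).
Proof.
move=> cE QE optQ; have leT := balanced_card v_balanced.
pose G := [set B : {set T} | [&& #|B| == d.+1, `[< in_cone v B x >] & Q B]].
have <- := @count_by_level T _ G (fun B => ~: B) violated E (#|T| - d.+1) e k cE.
- by apply: eq_card => B; rewrite !inE -!andbA.
- by lia.
- move=> B; rewrite inE => /and3P[/eqP cB _ QB]; split; first 1 last.
  + exact: QE.
  + by rewrite cardsCs setCK cB.
  apply/subsetP => t; rewrite !inE; apply: contraTN => /(w_tight cB) ->.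
  by rewrite ltxx.
- move=> X sXE cX; have [||B optB] := @optimal_basis_exists (~: X).
  + by rewrite cardsCs setCK; lia.
  + move=> u /v_balanced ltk.
    have /subsetPn[t] : ~~ ([set t | (0 < dotv u (v t))%R] \subset X).
      by apply/negP => /subset_leq_card; lia.
    by rewrite inE => ut tX; exists t; rewrite ?inE.
  apply/eqP/cards1P; exists B; apply/setP => B'; rewrite !inE.
  (* Feasibility of [w C] off [X] says that [X] contains everything that [C] violates; [C] being
     available says that [X] avoids [C]. *)
  have optP C : reflect (optimal_basis (~: X) C)
      [&& #|C| == d.+1, `[< in_cone v C x >], violated C \subset X & X \subset ~: C].
    apply: (iffP and4P) => [[/eqP cC /asboolP coneC sC sX]|[sC cC coneC oC]].
      split; rewrite // 1?subsetC // => t; rewrite inE => tX.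
      by rewrite leNgt; apply: contra tX => tC; rewrite (subsetP sC) // inE.
    split; first exact/eqP; first exact/asboolP; last by rewrite subsetC.
    apply/subsetP => t; rewrite inE; apply: contraTT => tX.
    by rewrite -leNgt oC // inE.
  apply/idP/eqP => [/andP[/and3P[h1 h2 _] /andP[h3 h4]]|->].
    by apply: optimal_basis_unique optB; apply/optP; rewrite h1 h2 h3.
  by have /optP/and4P[-> -> -> ->] := optB; rewrite (optQ X).
- by [].
Qed.

End Levels.

(** * Geometry of generic sets *)

Section FsetOfSet.
Context {K : choiceType} {A : {fset K}}.
Implicit Types X : {set A}.

(** Counting takes place in [{set A}], over the finite type of elements of [A]; this map returns to
    the finite sets of vectors of the statement. *)
Definition fset_of X : {fset K} := [fset val t | t in X].

Lemma mem_fset_of X (t : A) : (val t \in fset_of X) = (t \in X).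
Proof.
apply/imfsetP/idP => [[s sX /val_inj ->]//|tX]; by exists t.
Qed.

Lemma fset_ofS X : fset_of X `<=` A.
Proof. by apply/fsubsetP => b /imfsetP[t _ ->]; apply: valP. Qed.

Lemma fset_of_inj : injective fset_of.
Proof. exact: can_inj (@FSetK _ A). Qed.

Lemma card_fset_of X : #|` fset_of X| = #|X|.
Proof. by rewrite card_imfset ?cardE //; apply: val_inj. Qed.

Lemma big_fset_of (V : nmodType) X (F : K -> V) :
  \sum_(b <- fset_of X) F b = \sum_(t in X) F (val t).
Proof. by rewrite big_imfset ?big_enum // => s t _ _; apply: val_inj. Qed.

Lemma card_fset_sep (P : pred K) :
  #|` [fset y in A | P y]| = #|[set t : A | P (val t)]|.
Proof.
rewrite -card_fset_of; congr #|` _|; apply/fsetP => y; rewrite !inE.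
apply/andP/imfsetP => [[yA Py]|[t + ->]].
  by exists [` yA]; rewrite //= inE.
by rewrite /= inE => Pt; split=> //; apply: valP.
Qed.

Lemma card_fpowerset_sep (P : pred {fset K}) :
  #|` [fset B in fpowerset A | P B]| = #|[set X : {set A} | P (fset_of X)]|.
Proof.
transitivity #|` [fset fset_of X | X in [set X : {set A} | P (fset_of X)]]|.
  congr #|` _|; apply/fsetP => B; rewrite !inE fpowersetE.
  apply/andP/imfsetP => [[sBA PB]|[X + ->]].
    by exists (fsub A B); [rewrite /= inE|]; rewrite /fset_of fsubK.
  by rewrite /= inE => PX; rewrite fset_ofS.
by rewrite card_imfset ?cardE //; apply: fset_of_inj.
Qed.

(** [affinely_dependent] and [convex_hull] ask for coefficients on the whole space; 0 is the default
    outside [A]. *)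
Definition extend0 {R : nmodType} (c : A -> R) (b : K) : R := oapp c 0 (insub b).

Lemma extend0E {R : nmodType} (c : A -> R) t : extend0 c (val t) = c t.
Proof. by rewrite /extend0 valK. Qed.

End FsetOfSet.

Lemma free_coef0 (F : fieldType) (V : vectType F) (s : seq V) (c : V -> F) :
  free s -> \sum_(b <- s) c b *: b = 0 -> forall b, b \in s -> c b = 0.
Proof.
move=> /(@freeP _ _ _ (in_tuple s)) fs cs b /(nthP 0)[i lti <-].
apply: (fs (fun i => c s`_i) _ (Ordinal lti)).
by rewrite -[RHS]cs [RHS](big_nth 0) big_mkord.
Qed.

Section Geometry.
Context {R : realType} {d : nat} {A : {fset 'rV[R]_d.+1}}.
Implicit Types (X : {set A}) (x y w : 'rV[R]_d.+1).

Let v : A -> 'rV[R]_d.+1 := val.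

Lemma dotvv_usphere y : usphere R d y -> dotv y y = 1.
Proof. by rewrite /usphere /= -sqr_enorm => ->; rewrite expr1n. Qed.

Lemma usphere_neq0 y : usphere R d y -> y != 0.
Proof. by move=> /dotvv_usphere yy; rewrite -dotvv_eq0 yy oner_eq0. Qed.

Lemma generic_independent X : generic A -> #|X| = d.+1 -> independent v X.
Proof.
move=> [_ freeA _] cX c cE t tX; rewrite -extend0E.
apply: (@free_coef0 _ _ (fset_of X)); last by rewrite mem_fset_of.
  by rewrite freeA ?fset_ofS ?card_fset_of.
by rewrite big_fset_of -[RHS]cE; apply: eq_bigr => s _; rewrite extend0E.
Qed.

(** Otherwise applying [w] to the expansion of [v t] in [X] shows that its coefficients sum to 1, an
    affine dependence among [d.+2] points. *)
Lemma generic_off_hyperplane X w t : generic A -> #|X| = d.+1 ->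
  (forall s, s \in X -> dotv w (v s) = 1) -> t \notin X -> dotv w (v t) != 1.
Proof.
move=> genA cX wX tX; apply/eqP => wt.
have [e tE] := independent_spans (generic_independent genA cX) cX (v t).
have se : \sum_(s in X) e s = 1.
  rewrite -wt tE dotv_sumr; apply: eq_bigr => s sX.
  by rewrite dotvZr wX // mulr1.
pose c (s : A) := if s == t then -1 else e s.
have cX' s : s \in X -> c s = e s.
  by move=> sX; rewrite /c; case: eqP sX tX => // -> ->.
have [_ _ /(_ (fset_of (t |: X)))] := genA; apply.
- exact: fset_ofS.
- by rewrite card_fset_of cardsU1 tX cX.
exists (extend0 c); split.
- exists (val t); first by rewrite mem_fset_of setU11.
  by rewrite extend0E /c eqxx oppr_eq0 oner_eq0.
- rewrite big_fset_of big_setU1 //= extend0E {1}/c eqxx.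
  under eq_bigr => s sX do rewrite extend0E cX' //.
  by rewrite se addNr.
rewrite big_fset_of big_setU1 //= extend0E {1}/c eqxx.
under eq_bigr => s sX do rewrite extend0E cX' //.
by rewrite -/(v t) tE scaleN1r addNr.
Qed.

(** A zero coefficient would make [x] linearly dependent on [d] points of [A]. *)
Lemma generic_coef_neq0 X x (c : A -> R) : generic_wrt A x -> #|X| = d.+1 ->
  x = \sum_(t in X) c t *: v t -> forall t, t \in X -> c t != 0.
Proof.
move=> [xA [_ freeAx _]] cX xE t tX; apply/eqP => ct0.
have xnX : x \notin fset_of (X :\ t) by apply: contra xA; apply/fsubsetP/fset_ofS.
pose c' b := if b == x then -1 else extend0 c b.
have c'E s : c' (val s) = c s.
  by rewrite /c' extend0E; case: eqP => // sx; move: xA; rewrite -sx (valP s).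
suff: c' x = 0 by rewrite /c' eqxx => /eqP; rewrite oppr_eq0 oner_eq0.
apply: (@free_coef0 _ _ (x |` fset_of (X :\ t))); last by rewrite fset1U1.
  apply: freeAx; first by rewrite fsetUS // fset_ofS.
  by rewrite cardfsU1 xnX card_fset_of; move: cX; rewrite (cardsD1 t) tX.
rewrite big_fsetU1 //= {1}/c' eqxx big_fset_of scaleN1r {1}xE (big_setD1 t) //=.
rewrite ct0 scale0r add0r; apply/eqP; rewrite addrC subr_eq0; apply/eqP.
by apply: eq_bigr => s _; rewrite c'E.
Qed.

Lemma spherical_simplex_in_cone X x : usphere R d x ->
  spherical_simplex (fset_of X) x <-> in_cone v X x.
Proof.
move=> x1; split=> [[y [c [c0 _ ->]]] <-|[c c0 xE]].
  exists (fun t => (enorm (\sum_(b <- fset_of X) c b *: b))^-1 * c (val t)).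
    by move=> t tX; rewrite mulr_ge0 ?invr_ge0 ?sqrtr_ge0 // c0 // mem_fset_of.
  rewrite [in X in _ *: X]big_fset_of scaler_sumr.
  by apply: eq_bigr => t _; rewrite scalerA.
(* Dividing by [s] turns the conic combination into a convex one. *)
set s := \sum_(t in X) c t.
have s_gt0 : 0 < s.
  rewrite lt_def sumr_ge0 // andbT psumr_eq0 //.
  apply: contraNN (usphere_neq0 x1) => /allP c_eq0; rewrite xE big1 // => t tX.
  by have := c_eq0 t (mem_index_enum t); rewrite tX => /eqP ->; rewrite scale0r.
have snz : s != 0 by rewrite gt_eqF.
exists (s^-1 *: x); last first.
  rewrite enormZ ?invr_ge0 ?(ltW s_gt0) // (x1 : enorm x = 1) mulr1 invrK.
  by rewrite scalerA divff // scale1r.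
exists (extend0 (fun t => s^-1 * c t)); split.
- move=> b /imfsetP[t /= tX ->].
  by rewrite extend0E mulr_ge0 ?c0 // invr_ge0 ltW.
- rewrite big_fset_of; under eq_bigr do rewrite extend0E.
  by rewrite -mulr_sumr mulVf.
rewrite big_fset_of xE scaler_sumr; apply: eq_bigr => t _.
by rewrite extend0E scalerA.
Qed.

(* [w = u / t] for the cap [cap u t]. *)
Lemma insideE X w y : (1 <= d)%N -> generic A -> #|X| = d.+1 ->
    (forall t, t \in X -> dotv w (v t) = 1) -> usphere R d y ->
  inside (fset_of X) y <-> 1 < dotv w y.
Proof.
move=> d_gt0 genA cX wX y1; split.
  move=> [u [t [u1 /andP[t0 t1] uX [_ uy]]]].
  suff <- : t^-1 *: u = w by rewrite dotvZl ltr_pdivlMl // mulr1.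
  apply: dotv_basis_inj (generic_independent genA cX) cX _ => s sX.
  have [|_ us] := uX (val s); first by rewrite /= mem_fset_of.
  by rewrite wX // dotvZl us mulVf // gt_eqF.
move=> wy.
(* This makes the height [(enorm w)^-1] less than 1. If [w] had norm at most 1, expanding the square
   of [w - v t] would force [w = v t] for every [t] in [X], but [X] has at least two points since
   [d >= 1]. *)
have ww : 1 < dotv w w.
  rewrite ltNge; apply/negP => ww.
  have wE t : t \in X -> w = v t.
    move=> tX; apply/eqP; rewrite -subr_eq0 -dotvv_eq0 eq_le dotvv_ge0 andbT.
    have tt : dotv (v t) (v t) = 1.
      by apply: dotvv_usphere; case: genA => + _ _; apply; apply: valP.
    rewrite !(dotvBl, dotvBr) (dotvC _ w) wX // tt; lra.
  have /card_gt1P[s [t [sX tX /eqP[]]]] : (1 < #|X|)%N by rewrite cX.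
  by apply: val_inj; rewrite -[LHS](wE s) // (wE t).
have w0 : w != 0 by rewrite -dotvv_gt0 (lt_trans ltr01).
have e_gt0 := enorm_gt0 w0.
have e_gt1 : 1 < enorm w by rewrite -[1]sqrtr1 ltr_sqrt // (lt_trans ltr01).
have ei_gt0 : 0 < (enorm w)^-1 by rewrite invr_gt0.
exists ((enorm w)^-1 *: w), (enorm w)^-1; split.
- by rewrite /usphere /= enormZ ?mulVf ?gt_eqF // ltW.
- by rewrite ei_gt0 invf_lt1.
- move=> b /imfsetP[t /= tX ->]; split; last by rewrite dotvZl wX // mulr1.
  by case: genA => + _ _; apply; apply: valP.
by split=> //; rewrite dotvZl ltr_pMr.
Qed.

End Geometry.

(** * Points near a vertex, and the two covering counts *)

Lemma dotv_usphere_le1 (R : realType) (d : nat) (y z : 'rV[R]_d.+1) :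
  usphere R d y -> usphere R d z -> dotv y z <= 1.
Proof.
move=> /dotvv_usphere yy /dotvv_usphere zz; have := dotvv_ge0 (y - z).
rewrite !(dotvBl, dotvBr) yy zz (dotvC z y); lra.
Qed.

Lemma dotv_lt0_near_all (R : realType) (n : nat) (I : finType) (p : I -> 'rV[R]_n)
    (a : 'rV[R]_n) :
  exists2 e : R, 0 < e & forall i x, dotv (p i) a < 0 -> enorm (x - a) < e ->
    dotv (p i) x < 0.
Proof.
have [e eP] : {e : I -> R & forall i, 0 < e i /\
    (dotv (p i) a < 0 -> forall x, enorm (x - a) < e i -> dotv (p i) x < 0)}.
  apply: (@choice _ _ (fun i (e : R) => 0 < e /\ (dotv (p i) a < 0 ->
    forall x, enorm (x - a) < e -> dotv (p i) x < 0))) => i.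
  have [pa|pa] := ltrP (dotv (p i) a) 0; last by exists 1; rewrite ltr01.
  by have [e e0 eP] := dotv_lt0_near pa; exists e.
have [i0 _|I0] := pickP (@predT I); last by exists 1 => // i; have := I0 i.
case: (@arg_minP _ _ _ i0 predT e isT) => i1 _ min.
exists (e i1); first by have [] := eP i1.
move=> i x pa xa; have [_ /(_ pa)] := eP i; apply.
exact: lt_le_trans xa (min i isT).
Qed.

Theorem theorem8 (R : realType) (d k : nat) (A : {fset 'rV[R]_d.+1})
    (a : 'rV[R]_d.+1) (hd : (1 <= d)%N) (hA : generic A)
    (hbal : balanced k A) (ha : a \in A) :
  (forall x : 'rV[R]_d.+1, generic_wrt A x ->
     #|` hefty_at k A x| = 'C(d + k, k)) /\
  (exists2 e : R, 0 < e &
     forall x : 'rV[R]_d.+1, generic_wrt A x -> enorm (x - a) < e ->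
       #|` [fset B in hefty_at k A x | a \in B]| = 'C(d + k - 1, d - 1)).
Proof.
pose v : A -> 'rV[R]_d.+1 := val.
have indep (X : {set A}) : #|X| = d.+1 -> independent v X := generic_independent hA.
have [w w_tight] : {w : {set A} -> 'rV[R]_d.+1 &
    forall X : {set A}, #|X| = d.+1 -> forall t, t \in X -> dotv (w X) (v t) = 1}.
  (* On sets of the wrong size [w] takes the default value 0. *)
  apply: (@choice _ _ (fun (X : {set A}) (w : 'rV[R]_d.+1) =>
    #|X| = d.+1 -> forall t, t \in X -> dotv w (v t) = 1)) => X.
  have [/indep/independent_functional[w wX]|nX] := pselect (#|X| = d.+1).
    by exists w.
  by exists 0.
have w_ntight (X : {set A}) t : #|X| = d.+1 -> t \notin X -> dotv (w X) (v t) != 1.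
  by move=> cX; apply: generic_off_hyperplane (w_tight X cX).
have A1 (t : A) : usphere R d (v t) by case: hA => + _ _; apply; apply: valP.
have bal u : u != 0 -> (k < #|[set t | (0 < dotv u (v t))%R]|)%N.
  move=> u0; have e0 := enorm_gt0 u0; have ei0 : 0 < (enorm u)^-1 by rewrite invr_gt0.
  have := hbal ((enorm u)^-1 *: u); rewrite card_fset_sep => /(_ _).
  under eq_finset do rewrite dotvZl pmulr_rgt0 //.
  by apply; rewrite /usphere /= enormZ ?mulVf ?gt_eqF // ltW.
have leA : (d.+1 + k <= #|{: A}|)%N := balanced_card bal.
have heftyE x (X : {set A}) : generic_wrt A x ->
    `[< hefty k A (fset_of X) /\ spherical_simplex (fset_of X) x >]
      = [&& #|X| == d.+1, `[< in_cone v X x >] & #|violated v w X| == k].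
  move=> [_ [xA1 _ _]]; have x1 : usphere R d x by apply: xA1; rewrite /= fset1U1.
  have level : #|X| = d.+1 ->
      #|` [fset y in A | `[< inside (fset_of X) y >]]| = #|violated v w X|.
    move=> cX; rewrite card_fset_sep; apply: eq_card => t; rewrite !inE.
    apply/asboolP/idP; by rewrite (insideE hd hA cX (w_tight X cX) (A1 t)).
  apply/asboolP/and3P.
    move=> [[_ cX lX] sX]; rewrite card_fset_of in cX; rewrite level // in lX.
    by split; [exact/eqP|apply/asboolP/spherical_simplex_in_cone|exact/eqP].
  move=> [/eqP cX /asboolP/spherical_simplex_in_cone sX /eqP lX].
  by split; [split; rewrite ?card_fset_of ?level ?fset_ofS|exact: sX].
have count x (Q : pred {set A}) (E : {set A}) e : generic_wrt A x ->
    #|E| = (#|{: A}| - d.+1 + e.+1)%N ->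
    (forall B, Q B -> ~: B \subset E) ->
    (forall X B : {set A}, X \subset E -> optimal_basis v w x (~: X) B -> Q B) ->
    #|[set X : {set A} | [&& #|X| == d.+1, `[< in_cone v X x >], Q X
      & #|violated v w X| == k]]| = 'C(e + k, k).
  move=> gx; apply: card_level => //.
  - by move=> B t cB; apply: w_tight.
  - apply: usphere_neq0; case: gx => _ [+ _ _]; apply; by rewrite /= fset1U1.
  - by move=> B c cB xE t; apply: generic_coef_neq0 gx cB xE t.
split=> [x gx|].
  rewrite -(count x predT setT d gx) //; first last.
  - by rewrite cardsT subnK //; apply: leq_trans leA; apply: leq_addr.
  rewrite card_fpowerset_sep; apply: eq_card => X.
  by rewrite !inE heftyE.
(* Since [dotv a a = 1], [p X] is negative at [a] exactly when [dotv (w X) a < 1]. There are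
   finitely many [X], so one radius preserves all these signs, independently of [x]. *)
pose p X := w X - a.
have [e e0 near_a] := dotv_lt0_near_all p a.
exists e => // x gx xa; pose a0 : A := [` ha].
have -> : (d + k - 1)%N = (d - 1 + k)%N by lia.
have -> : 'C(d - 1 + k, d - 1) = 'C(d - 1 + k, k).
  by rewrite -[RHS]bin_sub ?leq_addl // addnK.
rewrite -(count x (fun X => a0 \in X) (~: [set a0]) (d - 1)%N gx).
- transitivity #|` [fset B in fpowerset A |
      `[< hefty k A B /\ spherical_simplex B x >] && (a \in B)]|.
    by congr #|` _|; apply/fsetP => B; rewrite !inE andbA.
  rewrite card_fpowerset_sep; apply: eq_card => X.
  rewrite !inE heftyE // (mem_fset_of X a0).
  by rewrite -!andbA [(a0 \in X) && _]andbC.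
- rewrite cardsCs setCK cards1; move: leA; set N := #|_|; lia.
- by move=> B aB; rewrite setCS sub1set.
move=> X B sXE [sB cB [c c0 xE] oB].
have a0X : a0 \in ~: X by rewrite inE; apply/negP => /(subsetP sXE); rewrite !inE eqxx.
apply/negPn/negP => anB.
(* The constraint of [a] holds at [w B] because [a] was not removed, and strictly because [a] is not
   in [B]. *)
have : dotv (p B) x < 0.
  apply: near_a xa; rewrite dotvBl (dotvv_usphere (A1 a0)) subr_lt0.
  by rewrite lt_neqAle (w_ntight B a0 cB anB) (oB a0 a0X).
(* Conversely, [a] satisfies every constraint and [x] lies in the cone of [B], so
   [dotv a x <= dotv (w B) x]. *)
rewrite dotvBl subr_lt0 ltNge => /negP; apply.
rewrite xE !dotv_sumr; apply: ler_sum => t tB; rewrite !dotvZr.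
by rewrite w_tight // ler_wpM2l ?c0 // dotv_usphere_le1 ?A1 //; apply: (A1 a0).
Qed.
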